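(* Let $I=\{1,\dots,n\}$ and $\Lambda=\{1',\dots,m'\}$ be finite non-empty sets, let $\tilde P=(\tilde p_{j',i})_{j'\in\Lambda,i\in I}$ be a $(0,1)$-matrix such that each row and each column of $\tilde P$ contains a non-zero entry, and let $\tilde M^0=M^0(\{1\};I,\Lambda;\tilde P)$ be the corresponding regular Rees matrix semigroup over the one-element group. Then $\tilde M^0$ contains a non-empty set $\mathcal{M}$ of minimal idempotents such that (1) the elements of $\mathcal{M}$ commute pairwise, (2) for every $0\neq x\in \tilde M^0$ there exist $e,f\in\mathcal{M}$ such that $exf\neq 0$, and (3) for all $x,y\in\tilde M^0$ and all $e,f\in\mathcal{M}$ one has $\{exgyf: g\in\mathcal{M}\}\subset\{0,exyf\}$, and moreover $\{exgyf:g\in\mathcal{M}\}\neq\{0\}$ if $exyf\neq 0$, if and only if, using independent permutations of rows and columns, the sandwich matrix $\tilde P$ can be reduced to the form $$\left(\begin{array}{c|c} E_k & B\\ \hline A & A\circ B\end{array}\right),$$ where $E_k$ is the identity matrix of some size $k\geq 1$, the matrix $A$ is row-regular and the matrix $B$ is column-regular. If $\tilde P$ can be reduced to this form, then $\tilde M^0$ contains exactly $k!$ maximal nilpotent subsemigroups, each of which has nilpotency class $k$.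
   Context: $\tilde M^0$ consists of a zero $0$ and the pairs $(i,j')$, $i\in I$, $j'\in\Lambda$, with product $(i,j')(k,l')=(i,l')$ if $\tilde p_{j',k}=1$ and $(i,j')(k,l')=0$ if $\tilde p_{j',k}=0$. The rows of $\tilde P$ are indexed by $\Lambda$ and the columns by $I$. A $(0,1)$-matrix is row-regular (resp. column-regular) if each row (resp. column) contains a non-zero element. The Boolean product $u\circ v$ of $(0,1)$-vectors $u=(u_1,\dots,u_r)$, $v=(v_1,\dots,v_r)$ is $0$ if $u_1v_1+\dots+u_rv_r=0$ (sum in the integers) and $1$ otherwise. The Boolean product $A\circ B$ of $(0,1)$-matrices of sizes $a\times b$ and $b\times c$ is the $a\times c$ $(0,1)$-matrix whose $(i,j)$ entry is the Boolean product of the $i$-th row of $A$ with the $j$-th column of $B$. The blocks $A$ and $B$ may have no rows, respectively no columns. For a finite semigroup $S$ with zero, $(a)=S^1aS^1$, where $S^1$ is $S$ with an identity adjoined if necessary; $R(S)=\{x:(x)\text{ is a nilpotent semigroup}\}$ is the radical; $\mathcal{D}$-classes (which coincide with $\mathcal{J}$-classes) are ordered by $\mathcal{D}_a\leq\mathcal{D}_b\Leftrightarrow(a)\subset(b)$; a non-zero $\mathcal{D}$-class $D$ is minimal if $D'\leq D$ implies $D'=D$ or $D'=\{0\}$; an idempotent is minimal if it is contained in a minimal $\mathcal{D}$-class of $S/R(S)$. A subsemigroup $T$ is nilpotent if $T^r=\{0\}$ for some $r\in\mathbb{N}$; the least such $r$ is its nilpotency class; a maximal nilpotent subsemigroup is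 an inclusion-maximal nilpotent subsemigroup. *)

(* Defs.v *)
From HB Require Import structures.
#[warnings="-notation-overridden,-ambiguous-paths"]
From mathcomp Require Export all_boot all_order all_algebra all_fingroup.
From mathcomp Require Export boolp.

Set Implicit Arguments.
Unset Strict Implicit.
Unset Printing Implicit Defensive.

Declare Scope semigroup_scope.
Delimit Scope semigroup_scope with sg.
Local Open Scope semigroup_scope.

(* The semigroupType of the library cannot be joined with finType: the join
   would have to be declared before that of the finite groups. *)
HB.mixin Record isSemigroup0 S := {
  smul : S -> S -> S;
  szero : S;
  smulA : associative smul;
  smul0s : left_zero szero smul;
  smuls0 : right_zero szero smul
}.

#[short(type="finSemigroup0Type")]
HB.structure Definition FinSemigroup0 := {S of isSemigroup0 S & Finite S}.

Bind Scope semigroup_scope with FinSemigroup0.sort.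

Notation "x * y" := (smul x y) : semigroup_scope.
Notation "0" := szero : semigroup_scope.

Section FiniteSemigroupWithZero.

Variable S : finSemigroup0Type.
Implicit Types (a b e x : S) (T U : {set S}) (r : nat).

(* S^1 is modelled by option S, None acting as the adjoined identity. When S
   already has an identity this changes none of the ideals below. *)
Definition lact (s : option S) a : S := if s is Some u then u * a else a.
Definition ract a (s : option S) : S := if s is Some u then a * u else a.

Definition left_ideal a : {set S} := [set lact s a | s : option S].
Definition right_ideal a : {set S} := [set ract a s | s : option S].
Definition principal_ideal a : {set S} :=
  [set ract (lact s a) t | s : option S, t : option S].

Definition subsemigroup T : Prop := {in T &, forall x y, x * y \in T}.

Definition set_prod T U : {set S} := [set x * y | x in T, y in U].

(* T^r, the set of all products of r elements of T; meaningful for r >= 1. *)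
Definition set_pow T r : {set S} := iter r.-1 (fun U => set_prod U T) T.

Definition nilpotent_set T : Prop :=
  exists2 r, (0 < r)%N & set_pow T r = [set 0].

Definition nilpotent_subsemigroup T : Prop :=
  subsemigroup T /\ nilpotent_set T.

Definition nilpotency_class T r : Prop :=
  [/\ (0 < r)%N, set_pow T r = [set 0]
    & forall q, (0 < q)%N -> set_pow T q = [set 0] -> (r <= q)%N].

Definition maximal_nilpotent_subsemigroup T : Prop :=
  nilpotent_subsemigroup T /\
  forall U, nilpotent_subsemigroup U -> T \subset U -> U = T.

Definition radical : {set S} :=
  [set x | `[< nilpotent_set (principal_ideal x) >]].

Definition green_L a b : bool := left_ideal a == left_ideal b.
Definition green_R a b : bool := right_ideal a == right_ideal b.
Definition green_D a b : bool := [exists c, green_L a c && green_R c b].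

Definition D_class a : {set S} := [set b | green_D a b].

Definition D_le a b : bool := principal_ideal a \subset principal_ideal b.

Definition minimal_D_class (D : {set S}) : Prop :=
  exists a, [/\ D = D_class a, D_class a != [set 0]
    & forall b, D_le b a -> D_class b = D_class a \/ D_class b = [set 0]].

Lemma lactA s x y : lact s (x * y) = lact s x * y.
Proof. by case: s => [u|] //=; rewrite smulA. Qed.

Lemma ractA s x y : ract (x * y) s = x * ract y s.
Proof. by case: s => [u|] //=; rewrite smulA. Qed.

Lemma principal_idealM x y :
  (principal_ideal (x * y) \subset principal_ideal x) *
  (principal_ideal (x * y) \subset principal_ideal y).
Proof.
split; apply/subsetP=> z /imset2P[s t _ _ ->].
- rewrite lactA; apply/imset2P.
  exists s (Some (ract y t)) => //=; exact: ractA.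
- apply/imset2P; exists (Some (lact s x)) t => //=; by rewrite lactA.
Qed.

Lemma set0_in_ideal x : 0 \in principal_ideal x.
Proof.
by apply/imset2P; exists (Some 0) None => //=; rewrite smul0s.
Qed.

Lemma set_powS T U r : T \subset U -> set_pow T r \subset set_pow U r.
Proof.
move=> TU; rewrite /set_pow; elim: r.-1 => //= q IH.
exact: imset2S.
Qed.

Lemma set_pow0 T r : 0 \in T -> 0 \in set_pow T r.
Proof.
move=> T0; rewrite /set_pow; elim: r.-1 => //= q IH.
by apply/imset2P; exists 0 0 => //; rewrite smul0s.
Qed.

Lemma nilpotent_set_sub T U :
  0 \in T -> T \subset U -> nilpotent_set U -> nilpotent_set T.
Proof.
move=> T0 TU [r r0 Ur]; exists r => //; apply/eqP; rewrite eqEsubset.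
by rewrite -{1}Ur set_powS //= sub1set set_pow0.
Qed.

Lemma radicalMr x y : x \in radical -> x * y \in radical.
Proof.
rewrite !inE => /asboolP Rx; apply/asboolP.
by apply: nilpotent_set_sub Rx; rewrite ?set0_in_ideal ?principal_idealM.
Qed.

Lemma radicalMl x y : y \in radical -> x * y \in radical.
Proof.
rewrite !inE => /asboolP Ry; apply/asboolP.
by apply: nilpotent_set_sub Ry; rewrite ?set0_in_ideal ?principal_idealM.
Qed.

(* The Rees quotient S/R(S): the elements outside R(S), and None for the
   class R(S), which is the zero of the quotient. *)
Definition radical_quotient : Type := option {x : S | x \notin radical}.

HB.instance Definition _ := Finite.on radical_quotient.

Definition quot_zero : radical_quotient := None.

Definition quot_proj x : radical_quotient := insub x.

Definition quot_mul (u v : radical_quotient) : radical_quotient :=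
  if (u, v) is (Some x, Some y) then quot_proj (val x * val y) else None.

Lemma quot_proj0 x : x \in radical -> quot_proj x = None.
Proof. by move=> Rx; apply: insubN; rewrite negbK. Qed.

Lemma quot_mulA : associative quot_mul.
Proof.
have projM x (v : {x : S | x \notin radical}) :
    quot_mul (quot_proj x) (Some v) = quot_proj (x * val v).
  rewrite {1}/quot_proj; case: insubP => [u _ <-|] //=.
  by rewrite negbK => Rx; rewrite quot_proj0 ?radicalMr.
have Mproj (v : {x : S | x \notin radical}) x :
    quot_mul (Some v) (quot_proj x) = quot_proj (val v * x).
  rewrite {1}/quot_proj; case: insubP => [u _ <-|] //=.
  by rewrite negbK => Rx; rewrite quot_proj0 ?radicalMl.
case=> [x|] // [y|] // [z|]; first by rewrite projM Mproj smulA.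
by rewrite /quot_mul; case: quot_proj.
Qed.

Fact quot_mul0s : left_zero quot_zero quot_mul.
Proof. by []. Qed.

Fact quot_muls0 : right_zero quot_zero quot_mul.
Proof. by case. Qed.

HB.instance Definition _ :=
  isSemigroup0.Build radical_quotient quot_mulA quot_mul0s quot_muls0.

End FiniteSemigroupWithZero.

Definition minimal_idempotent (S : finSemigroup0Type) (e : S) : Prop :=
  e * e = e /\
  exists2 D : {set radical_quotient S}, minimal_D_class D & quot_proj e \in D.

Section ZeroOneMatrices.

Local Open Scope nat_scope.

Definition row_regular m n (P : 'M[bool]_(m, n)) : Prop :=
  forall i, exists j, P i j.

Definition column_regular m n (P : 'M[bool]_(m, n)) : Prop :=
  forall j, exists i, P i j.

(* The coercion of bool to nat makes this a sum of integers. *)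
Definition bool_mulmx a b c (A : 'M[bool]_(a, b)) (B : 'M[bool]_(b, c)) :
    'M[bool]_(a, c) :=
  \matrix_(i, l) (\sum_j (A i j : nat) * (B j l : nat) != 0).

Definition bool_idmx k : 'M[bool]_k := \matrix_(i, j) (i == j).

Definition reducible_to_form m n (P : 'M[bool]_(m, n)) (k : nat) : Prop :=
  exists (p q : nat) (eqm : k + p = m) (eqn : k + q = n)
         (s : 'S_m) (t : 'S_n) (A : 'M[bool]_(p, k)) (B : 'M[bool]_(k, q)),
    [/\ row_regular A, column_regular B
      & row_perm s (col_perm t P)
        = castmx (eqm, eqn) (block_mx (bool_idmx k) B A (bool_mulmx A B))].

End ZeroOneMatrices.

(* rees_pair i j is the pair (i, j') with i in I and j' in Lambda; the rows of P
   are indexed by Lambda = 'I_m and the columns by I = 'I_n. *)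
Variant rees_matrix m n (P : 'M[bool]_(m, n)) : Type :=
  | rees_zero
  | rees_pair of 'I_n & 'I_m.

Arguments rees_zero {m n P}.
Arguments rees_pair {m n P} i j.

Section ReesMatrixSemigroup.

Variables (m n : nat) (P : 'M[bool]_(m, n)).

Definition rees_to_option (x : rees_matrix P) : option ('I_n * 'I_m) :=
  if x is rees_pair i j then Some (i, j) else None.

Definition option_to_rees (u : option ('I_n * 'I_m)) : rees_matrix P :=
  if u is Some (i, j) then rees_pair i j else rees_zero.

Fact rees_to_optionK : cancel rees_to_option option_to_rees.
Proof. by case. Qed.

HB.instance Definition _ :=
  Finite.copy (rees_matrix P) (can_type rees_to_optionK).

Definition rees_mul (x y : rees_matrix P) : rees_matrix P :=
  match x, y with
  | rees_pair i j, rees_pair k l => if P j k then rees_pair i l else rees_zero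
  | _, _ => rees_zero
  end.

Fact rees_mulA : associative rees_mul.
Proof.
case=> [|i j] [|k l] [|u v] //=; first by case: (P j k).
by case Elu: (P l u); case Ejk: (P j k); rewrite /= ?Elu ?Ejk.
Qed.

Fact rees_mul0s : left_zero rees_zero rees_mul.
Proof. by []. Qed.

Fact rees_muls0 : right_zero rees_zero rees_mul.
Proof. by case. Qed.

HB.instance Definition _ :=
  isSemigroup0.Build (rees_matrix P) rees_mulA rees_mul0s rees_muls0.

End ReesMatrixSemigroup.

(* Main.v *)
(* A set M as in (1)-(3) consists of k orthogonal idempotents (a_x, b_x'): they
   give the block E_k, and (3) says that the entry (j', i) of the sandwich matrix
   is the Boolean sum over x of the products p_(j', a_x) p_(b_x', i), which is
   the block form.  In terms of this factorization an element (i, j') is a set of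
   arcs on {1, ..., k}, and multiplication composes arcs.  The arcs of the
   elements of a nilpotent subsemigroup form a strict order, because a loop would
   be a non-zero idempotent; extending it to a linear order, one sees that the
   maximal nilpotent subsemigroups correspond to the k! linear orders.  The
   product of the k - 1 consecutive arcs is non-zero, and no chain is longer. *)
Require Import Defs.
From mathcomp Require Import zify.

Set Implicit Arguments.
Unset Strict Implicit.
Unset Printing Implicit Defensive.

Local Open Scope semigroup_scope.

(** * Linear orders on ['I_k] as permutations *)

Section Orderings.
Variable k : nat.
Implicit Types (s t : 'S_k) (x y : 'I_k).

Lemma card_perm_lt s x : #|[set y | s y < s x]| = s x.
Proof.
rewrite -(card_preimset (f := s^-1%g)); last exact: perm_inj.
rewrite -sum1_card -[RHS](card_ord (s x)) -[RHS]sum1_card.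
rewrite (big_ord_widen _ (fun=> 1%N) (ltnW (ltn_ord (s x)))).
by apply: eq_bigl => z; rewrite !inE permKV.
Qed.

(** One implication suffices because both orders are total: a pair reversed by [s] would be reversed
    by [t] too. The orders then agree, and each value is the number of smaller elements. *)
Lemma eq_perm_lt s t :
  (forall x y, s x < s y -> t x < t y) -> s = t.
Proof.
move=> st; apply/permP=> x; apply/val_inj.
rewrite -[LHS]card_perm_lt -[RHS]card_perm_lt.
apply: eq_card => y; rewrite !inE; apply/idP/idP=> [/st //|tyx].
case: (ltngtP (s y) (s x)) => // [/st|/val_inj/perm_inj eyx].
  by rewrite ltnNge (ltnW tyx).
by rewrite eyx ltnn in tyx.
Qed.

(** The number of [R]-predecessors increases strictly along [R]. Ties are broken by the index: [key]
    writes the pair (rank, index) in base [k], hence is injective, and counting smaller keys turns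
    it into a permutation. *)
Lemma linear_extension (R : rel 'I_k) :
  irreflexive R -> transitive R -> exists s, forall x y, R x y -> s x < s y.
Proof.
move=> Rirr Rtr.
pose rank x := #|[set z | R z x]|.
pose key x : nat := (rank x * k + x)%N.
have ltR x y : R x y -> rank x < rank y.
  move=> Rxy; apply/proper_card/properP; split.
    by apply/subsetP=> z; rewrite !inE => /Rtr; apply.
  by exists x; rewrite !inE ?Rirr.
have key_inj : injective key.
  move=> x y /(congr1 (modn^~ k)); rewrite /key !modnMDl !modn_small //.
  exact: val_inj.
have lt_pos x : #|[set z | key z < key x]| < k.
  rewrite -[ltnRHS]card_ord -cardsT; apply/proper_card/properP.
  by split; [exact: subsetT | exists x; rewrite !inE ?ltnn].
pose pos x := Ordinal (lt_pos x).
have posM x y : key x < key y -> pos x < pos y.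
  move=> xy; apply/proper_card/properP; split.
    by apply/subsetP=> z; rewrite !inE => /ltn_trans; apply.
  by exists x; rewrite !inE ?ltnn.
have pos_inj : injective pos.
  move=> x y exy; apply: key_inj.
  by case: (ltngtP (key x) (key y)) => // /posM; rewrite exy ltnn.
exists (perm pos_inj) => x y /ltR Rxy; rewrite !permE; apply: posM.
rewrite /key; have := ltn_ord x; nia.
Qed.

End Orderings.

(** * The block form and frames *)

Lemma extend_inj k n (a : 'I_k -> 'I_n) : injective a ->
  exists q (eqn : k + q = n) (t : 'S_n),
    forall x, t (cast_ord eqn (lshift q x)) = a x.
Proof.
move=> a_inj.
pose q := #|[predC codom a]|.
have eqn : (k + q = n)%N.
  by rewrite -[RHS]card_ord -(cardC [in codom a]) card_codom ?card_ord.
exists q, eqn.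
(* The values of [a] in order, then all other indices: read as a rearrangement of ['I_n], this list
   is the required permutation. *)
pose s := codom a ++ enum [predC codom a].
have sz : size s == n by rewrite size_cat size_codom card_ord -cardE eqn.
have ps : perm_eq (Tuple sz) (ord_tuple n).
  apply: uniq_perm; rewrite ?val_ord_tuple ?enum_uniq //=.
    rewrite cat_uniq enum_uniq andbT; apply/andP; split.
      by rewrite map_inj_uniq ?enum_uniq.
    by apply/hasPn=> i; rewrite mem_enum.
  by move=> i; rewrite mem_cat !mem_enum inE /=; case: (i \in codom a).
have /tuple_permP[t et] := ps.
exists t => x.
pose j := cast_ord eqn (lshift q x).
have -> : t j = nth (a x) (Tuple sz) j.
  by rewrite et -tnth_nth tnth_mktuple tnth_ord_tuple.
rewrite /= nth_cat size_codom card_ord ltn_ord.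
by rewrite (nth_map x) ?size_enum_ord // nth_ord_enum.
Qed.

(* Up to permutations P has the block form of the theorem iff there is a frame:
   a x and b x are the column and the row of the x-th diagonal entry of E_k. *)
Definition frame m n (P : 'M[bool]_(m, n)) k
    (a : 'I_k -> 'I_n) (b : 'I_k -> 'I_m) : Prop :=
  [/\ forall x y, P (b x) (a y) = (x == y),
      forall j, exists x, P j (a x),
      forall i, exists x, P (b x) i
    & forall j i, P j i = [exists x, P j (a x) && P (b x) i]].

Lemma bool_mulmxE p k q (A : 'M[bool]_(p, k)) (B : 'M[bool]_(k, q)) i l :
  bool_mulmx A B i l = [exists x, A i x && B x l].
Proof.
rewrite mxE sum_nat_eq0 negb_forall; apply: eq_existsb => x.
by case: (A i x); case: (B x l).
Qed.

(** The first [k] rows and columns of the block form are [b] and [a]. The factorization of [P] is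
    checked block by block: next to [E_k] the Boolean sum collapses to a single term, and in the
    last block it is the product of [A] and [B]. Conversely, [a] and [b] are extended to
    permutations, and [A] and [B] are read off. *)
Lemma reducible_frameP m n (P : 'M[bool]_(m, n)) k :
  reducible_to_form P k <->
  exists (a : 'I_k -> 'I_n) (b : 'I_k -> 'I_m), frame P a b.
Proof.
split=> [[p [q [eqm [eqn [s [t [A [B [rA cB]]]]]]]]] | [a [b [Pba rP cP PE]]]].
  subst m n; rewrite castmx_id => /matrixP E.
  pose M := block_mx (bool_idmx k) B A (bool_mulmx A B).
  have {}E j i : P (s j) (t i) = M j i by rewrite -E !mxE.
  have Ml j y : M (lshift p j) (lshift q y) = (j == y).
    by rewrite block_mxEul mxE.
  exists (t \o lshift q), (s \o lshift p); split=> [x y|j|i|j i] /=.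
  - by rewrite E Ml.
  - rewrite -[j](permKV s); set j' := (s^-1)%g j.
    case: (split_ordP j') => u ->; first by exists u; rewrite E Ml.
    by have [x Ax] := rA u; exists x; rewrite E block_mxEdl.
  - rewrite -[i](permKV t); set i' := (t^-1)%g i.
    case: (split_ordP i') => u ->; first by exists u; rewrite E Ml.
    by have [x Bx] := cB u; exists x; rewrite E block_mxEur.
  rewrite -[j](permKV s) -[i](permKV t).
  set j' := (s^-1)%g j; set i' := (t^-1)%g i.
  rewrite E; under eq_existsb do rewrite !E.
  case: (split_ordP j') => u ->; case: (split_ordP i') => v ->.
  - rewrite Ml; apply/eqP/existsP => [->|[x]]; first by exists v; rewrite Ml eqxx.
    by rewrite !Ml => /andP[/eqP-> /eqP].
  - rewrite block_mxEur; apply/idP/existsP => [Buv|[x]].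
      by exists u; rewrite Ml eqxx block_mxEur.
    by rewrite Ml block_mxEur => /andP[/eqP->].
  - rewrite block_mxEdl; apply/idP/existsP => [Auv|[x]].
      by exists v; rewrite Ml eqxx block_mxEdl Auv.
    by rewrite Ml block_mxEdl => /andP[Aux /eqP<-].
  - rewrite block_mxEdr bool_mulmxE; apply: eq_existsb => x.
    by rewrite block_mxEdl block_mxEur.
(* Equal columns (or rows) of the frame would put a second 1 in a row (or column) of the identity
   block. *)
have a_inj : injective a.
  by move=> x y axy; apply/eqP; rewrite -Pba -axy Pba.
have b_inj : injective b.
  by move=> x y bxy; apply/eqP; rewrite -Pba bxy Pba.
have [q [eqn [t ta]]] := extend_inj a_inj.
have [p [eqm [s sb]]] := extend_inj b_inj.
subst m n.
have {}ta x : t (lshift q x) = a x by rewrite -ta cast_ord_id.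
have {}sb x : s (lshift p x) = b x by rewrite -sb cast_ord_id.
exists p, q, erefl, erefl, s, t.
exists (\matrix_(i, x) P (s (rshift k i)) (a x))%R.
exists (\matrix_(x, l) P (b x) (t (rshift k l)))%R.
split=> [i|l|]; first by have [x] := rP (s (rshift k i)); exists x; rewrite mxE.
  by have [x] := cP (t (rshift k l)); exists x; rewrite mxE.
rewrite castmx_id; apply/matrixP=> j i; rewrite ![LHS]mxE.
case: (split_ordP j) => u ->; case: (split_ordP i) => v ->.
- by rewrite block_mxEul mxE sb ta Pba.
- by rewrite block_mxEur mxE sb.
- by rewrite block_mxEdl mxE ta.
- rewrite block_mxEdr bool_mulmxE PE; apply: eq_existsb => x.
  by rewrite !mxE.
Qed.

(** * Idempotents, Green's relations and zero *)

Section SemigroupLemmas.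
Variable S : finSemigroup0Type.
Implicit Types (x y z e : S) (T : {set S}).

Lemma idempotent_set_pow T e r : e \in T -> e * e = e -> e \in set_pow T r.
Proof.
move=> Te ee; rewrite /set_pow; elim: r.-1 => //= q IH.
by apply/imset2P; exists e e.
Qed.

Lemma nilpotent_idempotent T e : nilpotent_set T -> e \in T -> e * e = e -> e = 0.
Proof.
move=> [r _ Tr] Te ee; apply/set1P; rewrite -Tr.
exact: idempotent_set_pow.
Qed.

Lemma lact_comp (s t : option S) x : exists u, lact s (lact t x) = lact u x.
Proof.
case: s t => [s|] [t|] /=; first by exists (Some (s * t)); rewrite /= smulA.
- by exists (Some s).
- by exists (Some t).
- by exists None.
Qed.

Lemma ract_comp (s t : option S) x : exists u, ract (ract x s) t = ract x u.
Proof.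
case: s t => [s|] [t|] /=; first by exists (Some (s * t)); rewrite /= smulA.
- by exists (Some s).
- by exists (Some t).
- by exists None.
Qed.

Lemma green_LP x y :
  reflect (exists s t, x = lact s y /\ y = lact t x) (green_L x y).
Proof.
apply: (iffP eqP) => [E|[s [t [xy yx]]]].
  have /imsetP[s _ xs] : x \in left_ideal y.
    by rewrite -E; apply/imsetP; exists None.
  have /imsetP[t _ yt] : y \in left_ideal x.
    by rewrite E; apply/imsetP; exists None.
  by exists s, t.
apply/eqP; rewrite eqEsubset.
apply/andP; split; apply/subsetP=> z /imsetP[u _ ->].
  by have [w E] := lact_comp u s y; apply/imsetP; exists w; rewrite // xy.
by have [w E] := lact_comp u t x; apply/imsetP; exists w; rewrite // yx.
Qed.

Lemma green_RP x y :
  reflect (exists s t, x = ract y s /\ y = ract x t) (green_R x y).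
Proof.
apply: (iffP eqP) => [E|[s [t [xy yx]]]].
  have /imsetP[s _ xs] : x \in right_ideal y.
    by rewrite -E; apply/imsetP; exists None.
  have /imsetP[t _ yt] : y \in right_ideal x.
    by rewrite E; apply/imsetP; exists None.
  by exists s, t.
apply/eqP; rewrite eqEsubset.
apply/andP; split; apply/subsetP=> z /imsetP[u _ ->].
  by have [w E] := ract_comp s u y; apply/imsetP; exists w; rewrite // xy.
by have [w E] := ract_comp t u x; apply/imsetP; exists w; rewrite // yx.
Qed.

Lemma lact0 (s : option S) : lact s 0 = 0.
Proof. by case: s => //= u; rewrite smuls0. Qed.

Lemma ract0 (s : option S) : ract 0 s = 0.
Proof. by case: s => //= u; rewrite smul0s. Qed.

Lemma green_D_eq0 x y : green_D x y -> (x == 0) = (y == 0).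
Proof.
case/existsP=> z /andP[/green_LP[s [t [xz zx]]] /green_RP[u [v [zy yz]]]].
have -> : (x == 0) = (z == 0).
  by apply/eqP/eqP=> E; [rewrite zx E lact0 | rewrite xz E lact0].
by apply/eqP/eqP=> E; [rewrite yz E ract0 | rewrite zy E ract0].
Qed.

Lemma D_class0 : D_class (0 : S) = [set 0].
Proof.
apply/setP=> x; rewrite !inE; apply/idP/eqP => [/green_D_eq0|->].
  by rewrite eqxx => /esym/eqP.
by apply/existsP; exists 0; rewrite /green_L /green_R !eqxx.
Qed.

End SemigroupLemmas.

Section RadicalQuotient.
Variable S : finSemigroup0Type.
Implicit Types x y e : S.

(** The zero lies in the radical, so it is sent to the zero of the quotient, whose class is excluded
    from the minimal ones. *)
Lemma minimal_idempotent_neq0 e : minimal_idempotent e -> e != 0.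
Proof.
move=> [_ [D [z [-> Dz _]] De]]; apply/eqP=> e0; move: De Dz.
have -> : quot_proj e = 0.
  rewrite quot_proj0 // inE e0; apply/asboolP; exists 1%N => //.
  apply/setP=> x; rewrite inE; apply/imset2P/eqP => [[s t _ _ ->]|->].
    by rewrite lact0 ract0.
  by exists None None.
rewrite inE => /green_D_eq0 E.
by rewrite eqxx in E; rewrite (eqP E) D_class0 eqxx.
Qed.

Lemma quot_projM x y :
  quot_proj (x * y) = quot_proj x * quot_proj y :> radical_quotient S.
Proof.
have [Rx|nRx] := boolP (x \in radical S).
  by rewrite (quot_proj0 Rx) smul0s quot_proj0 ?radicalMr.
have [Ry|nRy] := boolP (y \in radical S).
  by rewrite (quot_proj0 Ry) smuls0 quot_proj0 ?radicalMl.
by rewrite {2 3}/quot_proj !insubT.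
Qed.

End RadicalQuotient.

(** * Minimal idempotents of a Rees matrix semigroup *)

Section ReesMatrices.
Variables (m n : nat) (P : 'M[bool]_(m, n)).
Local Notation S := (rees_matrix P).
Implicit Types (i : 'I_n) (j : 'I_m) (x y e : S).

Lemma rees_mulE i j i' j' :
  rees_pair i j * rees_pair i' j' = if P j i' then rees_pair i j' else 0 :> S.
Proof. by []. Qed.

Lemma rees_idempotent e : e != 0 -> e * e = e ->
  exists i j, e = rees_pair i j /\ P j i.
Proof.
case: e => [|i j] // _; rewrite rees_mulE; case: ifP => // Pji _.
by exists i, j.
Qed.

Hypotheses (rowP : row_regular P) (colP : column_regular P).

(** Regularity puts a non-zero idempotent into the ideal of every non-zero element, and a nilpotent
    set contains none. *)
Lemma rees_radical : radical S = [set 0].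
Proof.
apply/setP=> x; rewrite [RHS]inE; apply/idP/eqP => [|->]; last first.
  rewrite inE; apply/asboolP; exists 1%N => //.
  apply/setP=> y; rewrite inE; apply/imset2P/eqP => [[s t _ _ ->]|->].
    by rewrite lact0 ract0.
  by exists None None.
case: x => [|i j] // /[!inE] /asboolP Nx.
have [i' Pji'] := rowP j; have [j' Pj'i] := colP i.
have : rees_pair i' j \in principal_ideal (rees_pair i j : S).
  apply/imset2P; exists (Some (rees_pair i' j')) None => //=.
  by rewrite rees_mulE Pj'i.
by move=> Ie; have := nilpotent_idempotent Nx Ie; rewrite rees_mulE Pji' => /(_ erefl).
Qed.

Lemma quot_projE x : quot_proj x = 0 :> radical_quotient S -> x = 0.
Proof.
rewrite /quot_proj; case: insubP => // /negbNE Rx _.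
by move: Rx; rewrite rees_radical inE => /eqP.
Qed.

Lemma quot_green_D (u v : radical_quotient S) : u != 0 -> v != 0 -> green_D u v.
Proof.
have proj (w : radical_quotient S) : w != 0 -> exists i j, w = quot_proj (rees_pair i j).
  case: w => // -[w Rw] _; case: w Rw => [|i j] Rw.
    by exfalso; rewrite rees_radical inE eqxx in Rw.
  by exists i, j; rewrite /quot_proj insubT.
move=> /proj[i [j ->]] /proj[k [l ->]]; apply/existsP.
(* The intermediate element shares its second index with the left element and its first index with
   the right one; regularity supplies the multipliers. *)
exists (quot_proj (rees_pair k j)); apply/andP; split.
  apply/green_LP; have [i' Pi] := colP i; have [k' Pk] := colP k.
  exists (Some (quot_proj (rees_pair i k'))), (Some (quot_proj (rees_pair k i'))).
  by rewrite /= -!quot_projM !rees_mulE Pi Pk.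
apply/green_RP; have [j' Pj] := rowP j; have [l' Pl] := rowP l.
exists (Some (quot_proj (rees_pair l' j))), (Some (quot_proj (rees_pair j' l))).
by rewrite /= -!quot_projM !rees_mulE Pj Pl.
Qed.

(** All non-zero elements of the quotient form one class, which is therefore minimal. *)
Lemma rees_minimal_idempotent i j :
  P j i -> minimal_idempotent (rees_pair i j : S).
Proof.
move=> Pji; split; first by rewrite rees_mulE Pji.
set u := quot_proj _.
have u0 : u != 0 by apply/eqP=> /quot_projE.
have uu : u \in D_class u by rewrite inE quot_green_D.
exists (D_class u) => //; exists u; split=> // [|v _].
  by apply/eqP=> D0; rewrite D0 inE (negPf u0) in uu.
have [->|v0] := eqVneq v 0; [by right; exact: D_class0 | left].
apply/setP=> w; rewrite !inE; have [->|w0] := eqVneq w 0.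
  by apply/idP/idP=> /green_D_eq0; rewrite eqxx ?(negPf u0) ?(negPf v0).
by rewrite !quot_green_D.
Qed.

End ReesMatrices.

(** * Sets of idempotents satisfying (1)-(3), and frames *)

Definition mediating m n (P : 'M[bool]_(m, n)) (M : {set rees_matrix P}) : Prop :=
  M != set0
  /\ (forall e, e \in M -> minimal_idempotent e)
  /\ (forall e f, e \in M -> f \in M -> e * f = f * e)
  /\ (forall x : rees_matrix P, x != 0 ->
        exists e f, [/\ e \in M, f \in M & e * x * f != 0])
  /\ (forall (x y : rees_matrix P) e f, e \in M -> f \in M ->
        [set e * x * g * y * f | g in M] \subset [set 0; e * x * y * f]
        /\ (e * x * y * f != 0 ->
            [set e * x * g * y * f | g in M] != [set 0])).

Section Mediating.
Variables (m n : nat) (P : 'M[bool]_(m, n)).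
Local Notation S := (rees_matrix P).

(** The identity block gives (1) and the two covering conditions of a frame give (2). For (3), a
    middle factor [g] given by [x] survives between row [j] and column [i'] iff [x] witnesses
    [P j i'] in the factorization. *)
Lemma frame_mediating k (a : 'I_k -> 'I_n) (b : 'I_k -> 'I_m) :
  row_regular P -> column_regular P -> (0 < k)%N -> frame P a b ->
  mediating (P := P) [set rees_pair (a x) (b x) | x in 'I_k].
Proof.
move=> rowP colP k0 [Pba rP cP PE].
have inM x :
  (rees_pair (a x) (b x) : S) \in [set rees_pair (a x) (b x) | x in 'I_k].
  by apply/imsetP; exists x.
split; first by apply/set0Pn; exists (rees_pair (a (Ordinal k0)) (b (Ordinal k0))).
split; [|split; [|split]].
- move=> _ /imsetP[x _ ->]; apply: rees_minimal_idempotent => //.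
  by rewrite Pba.
- move=> _ _ /imsetP[x _ ->] /imsetP[y _ ->]; rewrite !rees_mulE !Pba eq_sym.
  by case: eqP => // ->.
- case=> [|i j] // _; have [x Px] := cP i; have [y Py] := rP j.
  exists (rees_pair (a x) (b x)), (rees_pair (a y) (b y)).
  by rewrite !rees_mulE Px rees_mulE Py.
move=> x y _ _ /imsetP[u _ ->] /imsetP[v _ ->].
have [->|x0] := eqVneq x 0.
  split; last by rewrite !(smuls0, smul0s) eqxx.
  by apply/subsetP=> _ /imsetP[g _ ->]; rewrite !(smuls0, smul0s) !inE eqxx.
have [->|y0] := eqVneq y 0.
  split; last by rewrite !(smuls0, smul0s) eqxx.
  by apply/subsetP=> _ /imsetP[g _ ->]; rewrite !(smuls0, smul0s) !inE eqxx.
case: x y x0 y0 => [|i j] // [|i' j'] // _ _.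
split.
  apply/subsetP=> _ /imsetP[_ /imsetP[x _ ->] ->]; rewrite !inE.
  rewrite !rees_mulE; case: ifP => // Pu; rewrite !rees_mulE.
  case: ifP => // Px; rewrite rees_mulE; case: ifP => // Px'.
  suff -> : P j i' by rewrite rees_mulE eqxx orbT.
  by rewrite PE; apply/existsP; exists x; rewrite Px.
rewrite !rees_mulE; case: ifP => // Pu; rewrite rees_mulE.
case: ifP => //; rewrite PE => /existsP[x /andP[Px Px']].
rewrite rees_mulE; case: ifP => // Pv _; apply/eqP=> E.
suff : (rees_pair (a u) (b v) : S) \in [set 0] by rewrite inE.
rewrite -E; apply/imsetP; exists (rees_pair (a x) (b x)) => //.
by rewrite rees_mulE Px rees_mulE Px' rees_mulE Pv.
Qed.

Lemma mediating_frame (M : {set S}) : (0 < m)%N -> (0 < n)%N ->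
  mediating M -> exists2 k, (0 < k)%N &
    exists (a : 'I_k -> 'I_n) (b : 'I_k -> 'I_m), frame P a b.
Proof.
move=> m0 n0 [Mn0 [minM [comM [covM medM]]]].
exists #|M|; first by rewrite card_gt0.
(* The default values are never taken, since the elements of [M] are non-zero. *)
pose a (x : 'I_#|M|) := if enum_val x is rees_pair i _ then i else Ordinal n0.
pose b (x : 'I_#|M|) := if enum_val x is rees_pair _ j then j else Ordinal m0.
have valE (x : 'I_#|M|) : enum_val x = rees_pair (a x) (b x) /\ P (b x) (a x).
  have me := minM _ (enum_valP x).
  have [i [j [E Pji]]] := rees_idempotent (minimal_idempotent_neq0 me) me.1.
  by rewrite /a /b E.
have inM x : (rees_pair (a x) (b x) : S) \in M.
  by rewrite -(valE x).1 enum_valP.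
have Mval e : e \in M -> exists x, e = rees_pair (a x) (b x).
  by move=> Me; exists (enum_rank_in Me e); rewrite -(valE _).1 enum_rankK_in.
exists a, b.
have Pba x y : P (b x) (a y) = (x == y).
  have [->|/eqP nxy] := eqVneq; first exact: (valE y).2.
  (* If the product of the two idempotents is non-zero, it is [rees_pair (a x) (b y)]; commuting
     makes it [rees_pair (a y) (b x)], so the two coincide. *)
  apply/negP=> Pxy; apply: nxy; apply: enum_val_inj.
  rewrite (valE x).1 (valE y).1; have := comM _ _ (inM x) (inM y).
  by rewrite !rees_mulE Pxy; case: ifP => // _ [-> ->].
have rP j : exists x, P j (a x).
  have [e [f [_ /Mval[y ->]]]] := covM (rees_pair (Ordinal n0) j) isT.
  case: e => [|i' j'] //; rewrite rees_mulE; case: ifP => // _.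
  by rewrite rees_mulE; case: ifP => // Py _; exists y.
have cP i : exists x, P (b x) i.
  have [e [f [/Mval[x ->] _]]] := covM (rees_pair i (Ordinal m0)) isT.
  by rewrite rees_mulE; case: ifP => // Px _; exists x.
split=> // j i; have [x Px] := cP (a (xchoose (rP j))).
pose u := xchoose (rP j); have Pju : P j (a u) := xchooseP (rP j).
have [w Pw] := cP i.
(* With these outer factors, the product without [g] is non-zero iff [P j i], and with the [v]-th
   idempotent as [g] iff [P j (a v) && P (b v) i]. *)
have [] := medM (rees_pair (a u) j) (rees_pair i (b w)) _ _ (inM u) (inM w).
have Puu y : P (b y) (a y) by rewrite Pba eqxx.
move=> /subsetP sub neq; apply/idP/existsP => [Pji|[v /andP[Pjv Pvi]]].
  move: neq; rewrite !rees_mulE Puu rees_mulE Pji rees_mulE Puu => /(_ isT) neq.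
  have [v Hv] : exists v, P j (a v) && P (b v) i; last by exists v.
  (* Without such a [v] every choice of [g] would give 0, against the second half of (3). *)
  apply/existsP; apply: contraNT neq; rewrite negb_exists => /forallP Hn.
  apply/eqP/setP=> y; rewrite inE; apply/imsetP/eqP => [[_ /Mval[v ->] ->]|->].
    have := Hn v; rewrite rees_mulE; case: ifP => // _.
    by rewrite rees_mulE /= => /negPf->.
  exists (rees_pair (a u) (b u)) => //; have := Hn u.
  by rewrite rees_mulE Pju rees_mulE /= => /negPf->.
(* The [v]-th idempotent gives this non-zero product, so the inclusion in (3) excludes that the
   product without [g] is 0. *)
have := sub (rees_pair (a u) (b w)); rewrite !inE /=.
rewrite !rees_mulE Puu rees_mulE; case: (P j i) => //; apply.
apply/imsetP; exists (rees_pair (a v) (b v)) => //.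
by rewrite rees_mulE Pjv rees_mulE Pvi rees_mulE Puu.
Qed.

End Mediating.

(** * Maximal nilpotent subsemigroups *)

Section Nilpotent.
Variables (m n : nat) (P : 'M[bool]_(m, n)) (k : nat).
Variables (a : 'I_k -> 'I_n) (b : 'I_k -> 'I_m).
Hypothesis Pab : frame P a b.
Local Notation S := (rees_matrix P).
Implicit Types (s t : 'S_k) (x y z : 'I_k) (T : {set S}).

(* An element (i, j') stands for the arcs x -> y with P (b x) i and P j (a y);
   the factorization of P says that products compose arcs. *)
Definition ordered_set s : {set S} :=
  [set u | if u is rees_pair i j then
     [forall x, forall y, P (b x) i && P j (a y) ==> (s x < s y)] else true].

Lemma ordered_setP s i j :
  reflect (forall x y, P (b x) i -> P j (a y) -> s x < s y)
          ((rees_pair i j : S) \in ordered_set s).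
Proof.
rewrite inE; apply: (iffP forallP) => [H x y bx ay|H x].
  by have /forallP/(_ y) := H x; rewrite bx ay.
by apply/forallP=> y; apply/implyP=> /andP[]; apply: H.
Qed.

Lemma zero_ordered_set s : (0 : S) \in ordered_set s.
Proof. by rewrite inE. Qed.

(** By the identity block, the element carries the single arc from [x] to [y]; thus the set
    determines the order. *)
Lemma ordered_set_frame s x y :
  ((rees_pair (a x) (b y) : S) \in ordered_set s) = (s x < s y).
Proof.
have [Pba _ _ _] := Pab; apply/ordered_setP/idP => [|sxy x' y'].
  by apply; rewrite Pba.
by rewrite !Pba => /eqP-> /eqP<-.
Qed.

Lemma ordered_set_subsemigroup s : subsemigroup (ordered_set s).
Proof.
have [_ _ _ PE] := Pab.
move=> [|i j] [|i' j'] Tu Tv; try exact: zero_ordered_set.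
rewrite rees_mulE PE; case: existsP => [[z /andP[jz zi']]|_]; last first.
  exact: zero_ordered_set.
apply/ordered_setP=> x y bx ay.
exact: ltn_trans (ordered_setP _ _ _ Tu x z bx jz) (ordered_setP _ _ _ Tv z y zi' ay).
Qed.

(* A non-zero product of r elements spans a chain of r + 1 elements of 'I_k. *)
Lemma ordered_set_pow s r i j : (0 < r)%N ->
  (rees_pair i j : S) \in set_pow (ordered_set s) r ->
  forall x y, P (b x) i -> P j (a y) -> (s x + r <= s y)%N.
Proof.
have [_ _ _ PE] := Pab.
case: r => // r _; rewrite /set_pow /=; elim: r i j => [|r IH] i j /=.
  by move/ordered_setP => H x y bx ay; rewrite addn1; exact: H.
case/imset2P=> [[|i1 j1] [|i2 j2]] // T1 /ordered_setP T2.
rewrite rees_mulE PE; case: existsP => // -[z /andP[j1z zi2]] [-> ->] x y bx ay.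
by rewrite addnS; apply: leq_trans (T2 z y zi2 ay); rewrite ltnS; exact: IH T1 _ _ _ _.
Qed.

(** A non-zero product of [k] elements would need two positions below [k] that differ by at least
    [k]. For fewer factors, consecutive arcs starting at position 0 compose to a non-zero
    element. *)
Lemma ordered_set_class s : (0 < k)%N -> nilpotency_class (ordered_set s) k.
Proof.
have [Pba rP cP _] := Pab; move=> k0; split=> //.
  apply/setP=> -[|i j]; rewrite [RHS]inE; last first.
    apply/negP=> Tij; have [x bx] := cP i; have [y ay] := rP j.
    have := ordered_set_pow k0 Tij bx ay; have := ltn_ord (s y); lia.
  by rewrite eqxx; apply: set_pow0; exact: zero_ordered_set.
move=> q q0 Tq; rewrite leqNgt; apply/negP=> qk.
(* The product of the [r.+1] arcs between consecutive positions 0, ..., [r.+1]. *)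
have pow r (rk : (r.+1 < k)%N) :
  (rees_pair (a (s^-1 (Ordinal k0))%g) (b (s^-1 (Ordinal rk))%g) : S)
    \in set_pow (ordered_set s) r.+1.
  rewrite /set_pow /=; elim: r rk => [|r IH] rk /=.
    by rewrite ordered_set_frame !permKV.
  apply/imset2P; pose y := (s^-1 (Ordinal (ltnW rk)))%g.
  exists (rees_pair (a (s^-1 (Ordinal k0))%g) (b y))
    (rees_pair (a y) (b (s^-1 (Ordinal rk))%g)); first exact: IH.
    by rewrite ordered_set_frame !permKV /=.
  by rewrite rees_mulE Pba eqxx.
case: q q0 Tq qk => // q _ Tq qk; have := pow q qk.
by rewrite Tq inE.
Qed.

(** Stated for inclusion, this gives both the injectivity needed for counting and the
    incomparability needed for maximality. *)
Lemma ordered_set_inj s t : ordered_set s \subset ordered_set t -> s = t.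
Proof.
move=> /subsetP st; apply: eq_perm_lt => x y.
by rewrite -!ordered_set_frame; exact: st.
Qed.

Lemma nilpotent_sub_ordered_set T :
  nilpotent_subsemigroup T -> exists s, T \subset ordered_set s.
Proof.
have [Pba rP cP PE] := Pab; move=> [subT nilT].
pose R x y := [exists i, exists j,
  [&& (rees_pair i j : S) \in T, P (b x) i & P j (a y)]].
have RP x y : reflect (exists i j, [/\ (rees_pair i j : S) \in T, P (b x) i & P j (a y)])
    (R x y).
  apply: (iffP existsP) => [[i /existsP[j /and3P[]]]|[i [j [H1 H2 H3]]]].
    by exists i, j.
  by exists i; apply/existsP; exists j; apply/and3P.
have Rirr : irreflexive R.
  move=> x; apply/RP=> -[i [j [Tij xi jx]]].
  have Pji : P j i by rewrite PE; apply/existsP; exists x; rewrite jx.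
  have := nilpotent_idempotent nilT Tij.
  by rewrite rees_mulE Pji => /(_ erefl).
have Rtr : transitive R.
  move=> y x z /RP[i [j [Tij xi jy]]] /RP[i' [j' [Tij' yi' j'z]]].
  apply/RP; exists i, j'; split=> //; have := subT _ _ Tij Tij'.
  (* The shared endpoint [y] makes the product non-zero, and that product carries the composed
     arc. *)
  suff Pji' : P j i' by rewrite rees_mulE Pji'.
  by rewrite PE; apply/existsP; exists y; rewrite jy.
have [s Rs] := linear_extension Rirr Rtr.
exists s; apply/subsetP=> -[|i j] Tij; first exact: zero_ordered_set.
apply/ordered_setP=> x y bx ay; apply: Rs.
by apply/RP; exists i, j.
Qed.

Lemma maximal_nilpotentP T : (0 < k)%N ->
  maximal_nilpotent_subsemigroup T <-> exists s, T = ordered_set s.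
Proof.
move=> k0.
have nil s : nilpotent_subsemigroup (ordered_set s).
  split; first exact: ordered_set_subsemigroup.
  by have [_ Tk _] := ordered_set_class s k0; exists k.
split=> [[nilT maxT]|[s ->]].
  have [s Ts] := nilpotent_sub_ordered_set nilT.
  by exists s; rewrite (maxT _ (nil s) Ts).
split=> // U nilU sU; have [t Ut] := nilpotent_sub_ordered_set nilU.
have st := ordered_set_inj (subset_trans sU Ut).
by apply/eqP; rewrite eqEsubset sU andbT st.
Qed.

Lemma card_maximal_nilpotent : (0 < k)%N ->
  #|[set T : {set S} | `[< maximal_nilpotent_subsemigroup T >]]| = k`!.
Proof.
move=> k0; rewrite -card_Sn -(card_imset _ (f := ordered_set)); last first.
  by move=> s t st; apply: ordered_set_inj; rewrite st.
apply: eq_card => T; rewrite inE; apply/asboolP/imsetP.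
  by move=> /(maximal_nilpotentP _ k0)[s ->]; exists s.
by move=> [s _ ->]; apply/maximal_nilpotentP => //; exists s.
Qed.

End Nilpotent.

Theorem theorem6p16 (m n : nat) (P : 'M[bool]_(m, n))
    (m_gt0 : (0 < m)%N) (n_gt0 : (0 < n)%N)
    (rowP : row_regular P) (colP : column_regular P) :
  ((exists M : {set rees_matrix P},
      M != set0
      /\ (forall e, e \in M -> minimal_idempotent e)
      /\ (forall e f, e \in M -> f \in M -> e * f = f * e)
      /\ (forall x : rees_matrix P, x != 0 ->
            exists e f, [/\ e \in M, f \in M & e * x * f != 0])
      /\ (forall (x y : rees_matrix P) e f, e \in M -> f \in M ->
            [set e * x * g * y * f | g in M] \subset [set 0; e * x * y * f]
            /\ (e * x * y * f != 0 ->
                [set e * x * g * y * f | g in M] != [set 0])))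
   <-> (exists2 k, (1 <= k)%N & reducible_to_form P k))
  /\ (forall k, (1 <= k)%N -> reducible_to_form P k ->
        #|[set T : {set rees_matrix P} |
             `[< maximal_nilpotent_subsemigroup T >]]| = k`!
        /\ (forall T : {set rees_matrix P},
              maximal_nilpotent_subsemigroup T -> nilpotency_class T k)).
Proof.
split.
  split=> [[M medM]|[k k0 /reducible_frameP[a [b Pab]]]].
    have [k k0 Pab] := mediating_frame m_gt0 n_gt0 medM.
    by exists k; last exact/reducible_frameP.
  by eexists; exact: frame_mediating Pab.
move=> k k0 /reducible_frameP[a [b Pab]].
split; first exact: card_maximal_nilpotent Pab k0.
move=> T /(maximal_nilpotentP Pab _ k0)[s ->].
exact: ordered_set_class.
Qed.
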